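(* For all $a,b\in\mathbb{Z}$, the power series \[ \frac{\mathrm{Sg}(a+b)}{(q^2;q^2)_{\infty}^{3}(q^2;q^4)_{\infty}^{2}}\sum_{n=a}^{b}(6n+1)q^{3n^2+n} \] has non-negative coefficient of $q^k$ for every integer $k\ge 1$.
   Context: $\mathrm{Sg}(x)=1$ if $x\ge 0$ and $\mathrm{Sg}(x)=-1$ if $x<0$. $(x;q)_\infty=\prod_{i\ge1}(1-xq^{i-1})$. An empty sum (when $a>b$) is $0$. *)

(* Defs.v *)
From HB Require Import structures.
From mathcomp Require Import all_boot all_order all_algebra.
From mathcomp Require Import boolp.

Set Implicit Arguments.
Unset Strict Implicit.
Unset Printing Implicit Defensive.

Import Order.TTheory GRing.Theory Num.Theory.
Local Open Scope ring_scope.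

(* Formal power series in one variable over R. This is a record rather than   *)
(* the bare type nat -> R so as not to inherit the pointwise product that     *)
(* mathcomp-analysis puts on function types.                                  *)
Record fps (R : Type) := Fps { coefs : nat -> R }.

HB.instance Definition _ (R : Type) := gen_eqMixin (fps R).
HB.instance Definition _ (R : Type) := gen_choiceMixin (fps R).

Lemma fpsP (R : Type) (f g : fps R) : coefs f =1 coefs g -> f = g.
Proof. by case: f g => [f] [g] /= /funext ->. Qed.

Section FpsZmod.
Variable R : zmodType.
Implicit Types f g h : fps R.

Definition fps_zero : fps R := Fps (fun=> 0).
Definition fps_opp f := Fps (fun k => - coefs f k).
Definition fps_add f g := Fps (fun k => coefs f k + coefs g k).

Fact fps_addA : associative fps_add.
Proof. by move=> f g h; apply: fpsP => k /=; rewrite addrA. Qed.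
Fact fps_addC : commutative fps_add.
Proof. by move=> f g; apply: fpsP => k /=; rewrite addrC. Qed.
Fact fps_add0 : left_id fps_zero fps_add.
Proof. by move=> f; apply: fpsP => k /=; rewrite add0r. Qed.
Fact fps_addN : left_inverse fps_zero fps_opp fps_add.
Proof. by move=> f; apply: fpsP => k /=; rewrite addNr. Qed.

HB.instance Definition _ :=
  GRing.isZmodule.Build (fps R) fps_addA fps_addC fps_add0 fps_addN.

Lemma coefs0 k : coefs (0 : fps R) k = 0. Proof. by []. Qed.
Lemma coefsD f g k : coefs (f + g) k = coefs f k + coefs g k.
Proof. by []. Qed.
Lemma coefsN f k : coefs (- f) k = - coefs f k. Proof. by []. Qed.
Lemma coefsB f g k : coefs (f - g) k = coefs f k - coefs g k.
Proof. by []. Qed.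
Lemma coefs_sum (I : Type) (r : seq I) (P : pred I) (F : I -> fps R) k :
  coefs (\sum_(i <- r | P i) F i) k = \sum_(i <- r | P i) coefs (F i) k.
Proof. by apply: (big_morph (fun f => coefs f k)). Qed.
End FpsZmod.

Section FpsRing.
Variable R : comNzRingType.
Implicit Types f g h : fps R.

Definition fps_one : fps R := Fps (fun k => (k == 0)%:R).
Definition fps_mul f g :=
  Fps (fun k => \sum_(i < k.+1) coefs f i * coefs g (k - i)).

Definition fps_trunc n f : {poly R} := \poly_(i < n) coefs f i.

Lemma coef_fps_trunc n f k : (k < n)%N -> (fps_trunc n f)`_k = coefs f k.
Proof. by move=> kn; rewrite coef_poly kn. Qed.

Lemma fps_mul_trunc n f g k : (k < n)%N ->
  coefs (fps_mul f g) k = (fps_trunc n f * fps_trunc n g)`_k.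
Proof.
move=> kn; rewrite coefM; apply: eq_bigr => i _.
rewrite !coef_fps_trunc //; first exact: leq_ltn_trans (leq_subr _ _) kn.
exact: leq_ltn_trans (leq_ord i) kn.
Qed.

Lemma fps_trunc_mul f g h k :
  coefs (fps_mul (fps_mul f g) h) k =
  (fps_trunc k.+1 f * fps_trunc k.+1 g * fps_trunc k.+1 h)`_k.
Proof.
rewrite (fps_mul_trunc _ _ (ltnSn k)) !coefM; apply: eq_bigr => i _.
by rewrite coef_fps_trunc // (fps_mul_trunc _ _ (ltn_ord i)).
Qed.

Fact fps_mulC : commutative fps_mul.
Proof.
by move=> f g; apply: fpsP => k; rewrite !(fps_mul_trunc _ _ (ltnSn k)) mulrC.
Qed.
Fact fps_mulA : associative fps_mul.
Proof.
move=> f g h; apply: fpsP => k; rewrite fps_mulC !fps_trunc_mul.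
by rewrite [_ * fps_trunc _ f]mulrC mulrA.
Qed.
Fact fps_mul1 : left_id fps_one fps_mul.
Proof.
move=> f; apply: fpsP => k /=; rewrite big_ord_recl /= subn0 mul1r big1 ?addr0//.
by move=> i _; rewrite /= mul0r.
Qed.
Fact fps_mulDl : left_distributive fps_mul (@GRing.add (fps R)).
Proof.
move=> f g h; apply: fpsP => k /=; rewrite -big_split /=.
by apply: eq_bigr => i _; rewrite mulrDl.
Qed.
Fact fps_one_neq0 : fps_one != 0 :> fps R.
Proof.
by apply/eqP => /(congr1 (fun f => coefs f 0)) /eqP; rewrite /= oner_eq0.
Qed.

HB.instance Definition _ :=
  GRing.Zmodule_isComNzRing.Build (fps R)
    fps_mulA fps_mulC fps_mul1 fps_mulDl fps_one_neq0.

Lemma coefs1 k : coefs (1 : fps R) k = (k == 0)%:R. Proof. by []. Qed.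
Lemma coefsM f g k :
  coefs (f * g) k = \sum_(i < k.+1) coefs f i * coefs g (k - i).
Proof. by []. Qed.
Lemma coefsM0 f g : coefs (f * g) 0 = coefs f 0 * coefs g 0.
Proof. by rewrite coefsM big_ord1. Qed.
End FpsRing.

Section FpsUnit.
Variable R : comUnitRingType.
Implicit Types f g : fps R.

(* The first n.+1 coefficients of the inverse of f. *)
Fixpoint fps_inv_seq f n : seq R :=
  if n is m.+1 then
    rcons (fps_inv_seq f m)
      (- ((coefs f 0)^-1 *
          \sum_(i < m.+1) coefs f i.+1 * (fps_inv_seq f m)`_(m - i)))
  else [:: (coefs f 0)^-1].

Definition fps_unit : {pred fps R} :=
  [pred f : fps R | coefs f 0 \is a GRing.unit].
Definition fps_inv f : fps R :=
  if f \in fps_unit then Fps (fun k => (fps_inv_seq f k)`_k) else f.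

Lemma size_fps_inv_seq f n : size (fps_inv_seq f n) = n.+1.
Proof. by elim: n => //= n IHn; rewrite size_rcons IHn. Qed.

Lemma nth_fps_inv_seq f n k : (k <= n)%N ->
  (fps_inv_seq f n)`_k = (fps_inv_seq f k)`_k.
Proof.
elim: n => [|n IHn]; first by rewrite leqn0 => /eqP ->.
rewrite leq_eqVlt => /predU1P[-> //|kn].
by rewrite /= nth_rcons size_fps_inv_seq kn IHn.
Qed.

Fact fps_mulVx : {in fps_unit, left_inverse 1 fps_inv *%R}.
Proof.
move=> f uf; rewrite mulrC; apply: fpsP => -[|k].
  by rewrite coefsM0 /fps_inv uf /= divrr.
rewrite coefsM /fps_inv uf /= big_ord_recl /= subn0.
rewrite nth_rcons size_fps_inv_seq ltnn eqxx mulrN mulVKr //.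
apply/eqP; rewrite addrC subr_eq0; apply/eqP; apply: eq_bigr => i _.
by rewrite /bump /= subSS [in RHS]nth_fps_inv_seq // leq_subr.
Qed.

Fact fps_unitPl f g : g * f = 1 -> fps_unit f.
Proof.
move=> /(congr1 (fun h => coefs h 0)); rewrite coefsM0 coefs1 /= => gf1.
by apply/unitrPr; exists (coefs g 0); rewrite mulrC.
Qed.

Fact fps_invr_out : {in [predC fps_unit], fps_inv =1 id}.
Proof. by move=> f; rewrite inE /fps_inv => /negPf ->. Qed.

HB.instance Definition _ :=
  GRing.ComNzRing_hasMulInverse.Build (fps R)
    fps_mulVx fps_unitPl fps_invr_out.

Lemma fps_unitE f : (f \is a GRing.unit) = (coefs f 0 \is a GRing.unit).
Proof. by []. Qed.
End FpsUnit.

#[global] Arguments coefs : simpl never.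

Section QPochhammer.
Variable R : comNzRingType.
Implicit Types x q : fps R.

Definition fpsX : fps R := Fps (fun k => (k == 1)%:R).

(* (x;q)_oo = \prod_(i >= 1) (1 - x q^(i-1)), where x and q are power series  *)
(* without constant term. The coefficient of index k only depends on the      *)
(* first k factors, so it is read off a finite product; see coefs_qpoch.      *)
Definition qpoch x q : fps R :=
  Fps (fun k => coefs (\prod_(1 <= i < k.+1) (1 - x * q ^+ (i - 1))) k).

Lemma coefsM_low x f n k : (forall j, (j < n)%N -> coefs x j = 0) ->
  (k < n)%N -> coefs (x * f) k = 0.
Proof.
move=> x0 kn; rewrite coefsM big1 // => i _.
by rewrite x0 ?mul0r // (leq_ltn_trans (leq_ord i)).
Qed.

Lemma coefs_mulX_low x q n : coefs x 0 = 0 -> coefs q 0 = 0 ->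
  forall j, (j <= n)%N -> coefs (x * q ^+ n) j = 0.
Proof.
move=> x0 q0; elim: n => [|n IHn] j.
  by rewrite leqn0 => /eqP ->; rewrite mulr1.
move=> jn; rewrite exprSr mulrA coefsM big_ord_recr /= subnn q0 mulr0 addr0.
rewrite big1 // => i _; rewrite IHn ?mul0r //.
by rewrite -ltnS (leq_trans (ltn_ord i)).
Qed.

Lemma coefs_qpoch x q k n : coefs x 0 = 0 -> coefs q 0 = 0 -> (k <= n)%N ->
  coefs (\prod_(1 <= i < n.+1) (1 - x * q ^+ (i - 1))) k = coefs (qpoch x q) k.
Proof.
move=> x0 q0; elim: n => [|n IHn]; first by rewrite leqn0 => /eqP ->.
rewrite leq_eqVlt => /predU1P[-> //|kn].
rewrite big_nat_recr //= subn1 /= mulrBr mulr1 coefsB IHn // mulrC.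
rewrite (@coefsM_low _ _ n.+1) ?subr0 // => j jn.
exact: coefs_mulX_low.
Qed.

Lemma coefs0_qpoch x q : coefs (qpoch x q) 0 = 1.
Proof. by rewrite /qpoch /coefs big_geq. Qed.
End QPochhammer.

Lemma qpoch_unit (R : comUnitRingType) (x q : fps R) :
  qpoch x q \is a GRing.unit.
Proof. by rewrite fps_unitE coefs0_qpoch unitr1. Qed.

Definition Sg (x : int) : int := if 0 <= x then 1 else -1.

(* The integers a, a + 1, ..., b, hence the empty sequence when b < a. *)
Definition zrange (a b : int) : seq int :=
  if a <= b then [seq a + i%:Z | i <- iota 0 `|b - a|%N.+1] else [::].

Lemma mem_zrange (a b n : int) : (n \in zrange a b) = (a <= n <= b).
Proof.
rewrite /zrange; case: ifPn => [ab|ab]; last first.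
  by rewrite in_nil; apply/esym/negP => /andP[an /(le_trans an)]; apply/negP.
have abE : (`|b - a|%N)%:Z = b - a by rewrite gez0_abs // subr_ge0.
apply/mapP/andP => [[i]|[an nb]].
  rewrite mem_iota add0n ltnS /= => ib ->; rewrite lerDl; split=> //.
  by rewrite addrC -lerBrDr -abE lez_nat.
exists `|n - a|%N; last by rewrite gez0_abs ?subr_ge0 // addrCA subrr addr0.
rewrite mem_iota add0n ltnS /= -lez_nat abE gez0_abs ?subr_ge0 //.
by rewrite lerD2r.
Qed.

Lemma zrange_uniq (a b : int) : uniq (zrange a b).
Proof.
rewrite /zrange; case: ifP => // _; rewrite map_inj_uniq ?iota_uniq //.
by move=> i j /addrI [].
Qed.

(* The exponent 3 n^2 + n is a nonnegative integer, so taking its absolute    *)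
(* value is only a cast to nat.                                               *)
Definition texp (n : int) : nat := absz (3 * n ^+ 2 + n).

Lemma texpE (n : int) : (texp n)%:Z = 3 * n ^+ 2 + n.
Proof.
rewrite /texp gez0_abs //; case: n => n.
  by rewrite addr_ge0 // mulr_ge0 // sqr_ge0.
by rewrite NegzE sqrrN subr_ge0 expr2 mulrA ler_peMl.
Qed.

(* Main.v *)
Require Import Defs.
From HB Require Import structures.
From mathcomp Require Import all_boot all_order all_algebra.
From mathcomp Require Import ring zify lra.
Set Implicit Arguments.
Unset Strict Implicit.
Unset Printing Implicit Defensive.
Import Order.TTheory GRing.Theory Num.Theory.
Local Open Scope ring_scope.

(** With x = q^2, the sum over all n of (6n+1) x^(n(3n+1)/2) is the product in
    the denominator: the double sum of (-1)^(i+j) (2j+1+4i) x^(j(j+1)/2 + i^2)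
    is twice (Jacobi's series for (x;x)^3) times (Gauss's series), because the
    series of (-1)^j x^(j(j+1)/2) over Z vanishes; split along j - i mod 3, it
    is also twice the sum above times Euler's pentagonal series at x^2.  All
    these are limits of one finite triple product, taken modulo powers of q.
    Dropping terms of constant sign leaves the sums over [-c, c] and [-c-1, c].
    Each is the denominator minus a tail, and summation by parts shows that the
    tail has coefficients of the right sign after division by (1 - x)^2. *)

(** * Gaussian binomial coefficients *)

Section GaussBinomial.
Variables (R : comNzRingType) (q : R).

(** The recursion is the q-Pascal rule: nothing is divided by [1 - q ^+ i], so any commutative ring
    will do. *)
Fixpoint gbin (M k : nat) : R :=
  match M, k with
  | _, 0 => 1
  | 0, _.+1 => 0
  | M'.+1, k'.+1 => gbin M' k' + q ^+ k'.+1 * gbin M' k'.+1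
  end.

Definition qfact (n : nat) : R := \prod_(i < n) (1 - q ^+ i.+1).

Lemma gbin0 M : gbin M 0 = 1. Proof. by case: M. Qed.

Lemma gbinSS M k : gbin M.+1 k.+1 = gbin M k + q ^+ k.+1 * gbin M k.+1.
Proof. by []. Qed.

Lemma gbin_small M k : (M < k)%N -> gbin M k = 0.
Proof.
elim: M k => [|M IHM] [|k] //= Mk.
by rewrite !IHM ?mulr0 ?addr0 // ltnW.
Qed.

#[local] Arguments gbin : simpl never.

(** The mirror image of the defining q-Pascal rule. The defining rule lets the triple product grow
    to the left, this one lets it grow to the right. *)
Lemma gbinSS_dual M k : (k <= M)%N ->
  gbin M.+1 k.+1 = q ^+ (M - k) * gbin M k + gbin M k.+1.
Proof.
elim: M k => [|M IHM] [|k] kM //.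
- by rewrite gbinSS gbin0 gbin_small // mulr0 addr0 mulr1 addr0.
- rewrite gbinSS [in LHS](IHM 0) // [in RHS]gbinSS !subn0 !gbin0 expr1 [q ^+ M.+1]exprS; ring.
- move: kM; rewrite ltnS leq_eqVlt => /predU1P[->|kM].
    by rewrite gbinSS subnn expr0 mul1r (@gbin_small M.+1 M.+2) // mulr0.
  rewrite gbinSS [in LHS](IHM k) ?(ltnW kM) // [in LHS](IHM k.+1) // subSS.
  have -> : (M - k)%N = (M - k.+1).+1 by lia.
  rewrite [gbin M.+1 k.+1]gbinSS [gbin M.+1 k.+2]gbinSS.
  rewrite [q ^+ k.+2]exprS [q ^+ (M - k.+1).+1]exprS.
  have -> : q ^+ k.+1 = q * q ^+ k by rewrite exprS.
  by ring.
Qed.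

Lemma qfactS n : qfact n.+1 = qfact n * (1 - q ^+ n.+1).
Proof. by rewrite /qfact big_ord_recr. Qed.

(** Induction on M through 1 - q^(M+1) = (1 - q^(k+1)) + q^(k+1) (1 - q^(M-k)). *)
Lemma gbin_qfact M k : (k <= M)%N ->
  gbin M k * qfact k * qfact (M - k) = qfact M.
Proof.
elim: M k => [|M IHM] [|k] kM //; rewrite ?gbin0 ?subn0 ?mul1r //.
- by rewrite /qfact !big_ord0 mulr1.
- by rewrite /qfact !big_ord0 mul1r.
have kM' : (k <= M)%N by [].
rewrite gbinSS subSS !mulrDl {1}qfactS.
have -> : gbin M k * (qfact k * (1 - q ^+ k.+1)) * qfact (M - k) =
  (1 - q ^+ k.+1) * (gbin M k * qfact k * qfact (M - k)) by ring.
rewrite IHM // [qfact M.+1]qfactS.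
move: kM'; rewrite leq_eqVlt => /predU1P[->|ltkM].
  by rewrite gbin_small // !mulr0 !mul0r addr0; ring.
have e : (M - k)%N = (M - k.+1).+1 by lia.
rewrite e [qfact (M - k.+1).+1]qfactS -e.
have -> : q ^+ k.+1 * gbin M k.+1 * qfact k.+1 *
    (qfact (M - k.+1) * (1 - q ^+ (M - k))) = q ^+ k.+1 * (1 - q ^+ (M - k)) *
    (gbin M k.+1 * qfact k.+1 * qfact (M - k.+1)) by ring.
rewrite IHM //.
have -> : M.+1 = (k.+1 + (M - k))%N by lia.
by rewrite exprD; ring.
Qed.

Lemma sum_gbinS (f : nat -> R) M :
  \sum_(k < M.+2) f k * gbin M.+1 k =
  \sum_(k < M.+1) f k.+1 * gbin M k + \sum_(k < M.+1) f k * q ^+ k * gbin M k.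
Proof.
rewrite big_ord_recl /= gbin0.
under eq_bigr do rewrite /bump add1n gbinSS mulrDr mulrA.
rewrite big_split /= addrCA; congr (_ + _).
rewrite [in RHS]big_ord_recl /= expr0 gbin0 !mulr1; congr (_ + _).
by rewrite big_ord_recr /= gbin_small // mulr0 addr0.
Qed.

Lemma sum_gbinS_dual (f : nat -> R) M :
  \sum_(k < M.+2) f k * gbin M.+1 k =
  \sum_(k < M.+1) f k * gbin M k +
  \sum_(k < M.+1) f k.+1 * q ^+ (M - k) * gbin M k.
Proof.
rewrite big_ord_recl /= gbin0.
under eq_bigr => k _ do
  rewrite /bump add1n (gbinSS_dual (leq_ord k)) mulrDr mulrA.
rewrite big_split /= addrA addrAC; congr (_ + _).
rewrite [in RHS]big_ord_recl /= gbin0; congr (_ + _).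
by rewrite big_ord_recr /= gbin_small // mulr0 addr0.
Qed.

End GaussBinomial.

(** * Finite form of Jacobi's triple product *)

Section FiniteTripleProduct.
Variables (R : comNzRingType) (p r : R) (t : int -> R).
Local Notation q := (p * r).
Hypothesis t0 : t 0 = 1.
Hypothesis tS : forall n : nat, t n.+1%:Z = t n%:Z * (p * q ^+ n).
Hypothesis tN : forall n : nat, t (- n.+1%:Z) = t (- n%:Z) * (r * q ^+ n).

(** The hypotheses force t j = p^(j(j+1)/2) r^(j(j-1)/2), so this is a finite theta series over j =
    k - b from -b to a. The weight c is free: c = 1 gives the triple product, c = id its
    derivative. *)
Definition theta (c : int -> int) (a b : nat) : R :=
  \sum_(k < (a + b).+1)
     (c (k%:Z - b%:Z))%:~R * t (k%:Z - b%:Z) * gbin q (a + b) k.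

Lemma t_up (a b k : nat) : (k <= a + b)%N ->
  t (k.+1%:Z - b%:Z) * q ^+ (a + b - k) = t (k%:Z - b%:Z) * (p * q ^+ a).
Proof.
move=> kab; have [bk|kb] := leqP b k.
  have -> : k.+1%:Z - b%:Z = (k - b).+1%:Z by lia.
  have -> : k%:Z - b%:Z = (k - b)%:Z by lia.
  rewrite tS -!mulrA -exprD; congr (_ * (_ * _ ^+ _)); lia.
have -> : k.+1%:Z - b%:Z = - (b - k.+1)%:Z by lia.
have -> : k%:Z - b%:Z = - (b - k.+1).+1%:Z by lia.
rewrite tN -!mulrA; congr (_ * _).
rewrite [q ^+ _ * (p * _)]mulrCA -exprD mulrA [r * p]mulrC -exprS; congr (_ ^+ _); lia.
Qed.

Lemma t_down (b k : nat) :
  t (k%:Z - b.+1%:Z) * q ^+ k = t (k%:Z - b%:Z) * (r * q ^+ b).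
Proof.
have [bk|kb] := leqP b.+1 k.
  have -> : k%:Z - b%:Z = (k - b.+1).+1%:Z by lia.
  have -> : k%:Z - b.+1%:Z = (k - b.+1)%:Z by lia.
  rewrite tS -!mulrA; congr (_ * _).
  rewrite [q ^+ _ * (r * _)]mulrCA -exprD mulrA -exprS; congr (_ ^+ _); lia.
have -> : k%:Z - b.+1%:Z = - (b - k).+1%:Z by lia.
have -> : k%:Z - b%:Z = - (b - k)%:Z by lia.
rewrite tN -!mulrA -exprD; congr (_ * (_ * _ ^+ _)); lia.
Qed.

Lemma theta00 c : theta c 0 0 = (c 0)%:~R.
Proof. by rewrite /theta big_ord1 subrr t0 gbin0 !mulr1. Qed.

Lemma theta_up c a b : theta c a.+1 b =
  theta c a b + p * q ^+ a * theta (fun j => c (j + 1)) a b.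
Proof.
rewrite /theta addSn.
rewrite (sum_gbinS_dual _ (fun k => (c (k%:Z - b%:Z))%:~R * t (k%:Z - b%:Z))).
congr (_ + _).
rewrite mulr_sumr; apply: eq_bigr => k _.
rewrite -[_ * t _ * _ ^+ _]mulrA t_up ?leq_ord //.
have -> : k.+1%:Z - b%:Z = k%:Z - b%:Z + 1 by lia.
by ring.
Qed.

Lemma theta_down c a b : theta c a b.+1 =
  theta c a b + r * q ^+ b * theta (fun j => c (j - 1)) a b.
Proof.
rewrite /theta addnS.
rewrite (sum_gbinS _ (fun k => (c (k%:Z - b.+1%:Z))%:~R * t (k%:Z - b.+1%:Z))).
congr (_ + _).
  by apply: eq_bigr => k _; have -> : k.+1%:Z - b.+1%:Z = k%:Z - b%:Z by lia.
rewrite mulr_sumr; apply: eq_bigr => k _.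
rewrite -[_ * t _ * _ ^+ _]mulrA t_down.
have -> : k%:Z - b.+1%:Z = k%:Z - b%:Z - 1 by lia.
by ring.
Qed.

Lemma theta_one a b : theta (fun=> 1) a b =
  \prod_(i < a) (1 + p * q ^+ i) * \prod_(i < b) (1 + r * q ^+ i).
Proof.
elim: b => [|b IHb]; last by rewrite theta_down IHb big_ord_recr /=; ring.
elim: a => [|a IHa]; first by rewrite theta00 !big_ord0 mulr1.
by rewrite theta_up IHa [in RHS]big_ord_recr /=; ring.
Qed.

Lemma theta_addc c d a b :
  theta (fun j => c j + d j) a b = theta c a b + theta d a b.
Proof.
rewrite /theta -big_split; apply: eq_bigr => k _ /=.
by rewrite rmorphD !mulrDl.
Qed.

Lemma theta_oppc c a b : theta (fun j => - c j) a b = - theta c a b.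
Proof.
rewrite /theta -sumrN; apply: eq_bigr => k _ /=.
by rewrite rmorphN !mulNr.
Qed.

(* The derivative in z at z = 1 of the finite triple product in p z, r / z,
   at a zero r = -1 of that product. *)
Lemma theta_id a b : r = -1 -> theta id a b.+1 =
  \prod_(i < a) (1 + p * q ^+ i) * \prod_(i < b) (1 + r * q ^+ i.+1).
Proof.
move=> r1.
(* For r = -1 the factor 1 + r at i = 0 kills the unweighted sum. *)
have th0 a' b' : theta (fun=> 1) a' b'.+1 = 0.
  by rewrite theta_one big_ord_recl /= expr0 mulr1 r1 subrr mul0r mulr0.
elim: b => [|b IHb].
  rewrite theta_down expr0 mulr1 theta_addc [theta (fun=> - 1) _ _]theta_oppc.
  by rewrite theta_one r1 !big_ord0; ring.
rewrite theta_down theta_addc [theta (fun=> - 1) _ _]theta_oppc th0 IHb.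
by rewrite [in RHS]big_ord_recr /=; ring.
Qed.

End FiniteTripleProduct.

(** * Congruences modulo powers of X, and limits of finite theta series *)

Section Truncation.
Variable R : comUnitRingType.
Implicit Types (f g h u : fps R) (K n : nat).

(** Congruence modulo X^K, which stands in for convergence. *)
Definition eqX K f g := forall j, (j < K)%N -> coefs f j = coefs g j.

Lemma eqX_refl K f : eqX K f f. Proof. by []. Qed.

Lemma eqX_sym K f g : eqX K f g -> eqX K g f.
Proof. by move=> fg j jK; rewrite fg. Qed.

Lemma eqX_trans K g f h : eqX K f g -> eqX K g h -> eqX K f h.
Proof. by move=> fg gh j jK; rewrite fg ?gh. Qed.

Lemma eqXD K f f' g g' : eqX K f f' -> eqX K g g' -> eqX K (f + g) (f' + g').
Proof. by move=> ff gg j jK; rewrite !coefsD ff ?gg. Qed.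

Lemma eqXM K f f' g g' : eqX K f f' -> eqX K g g' -> eqX K (f * g) (f' * g').
Proof.
move=> ff gg j jK; rewrite !coefsM; apply: eq_bigr => i _.
by rewrite ff ?gg //; [exact: leq_ltn_trans (leq_subr _ _) jK | have := ltn_ord i; lia].
Qed.

Lemma eqX_sum K (I : Type) (s : seq I) (P : pred I) (F G : I -> fps R) :
  (forall i, P i -> eqX K (F i) (G i)) ->
  eqX K (\sum_(i <- s | P i) F i) (\sum_(i <- s | P i) G i).
Proof. by move=> FG j jK; rewrite !coefs_sum; apply: eq_bigr => i /FG ->. Qed.

Lemma eqX_mul2l K u f g : u \is a GRing.unit ->
  eqX K (u * f) (u * g) -> eqX K f g.
Proof.
by move=> uu /(eqXM (@eqX_refl K u^-1)); rewrite !mulKr.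
Qed.

Lemma coefsX k : coefs (fpsX R) k = (k == 1%N)%:R. Proof. by []. Qed.

Lemma coefsXM f k :
  coefs (fpsX R * f) k = if k is k'.+1 then coefs f k' else 0.
Proof.
case: k => [|k]; first by rewrite coefsM0 coefsX mul0r.
rewrite coefsM big_ord_recl coefsX mul0r add0r big_ord_recl coefsX mul1r.
rewrite big1 => [|i _]; last by rewrite coefsX mul0r.
by rewrite addr0 subSS subn0.
Qed.

Lemma coefsXnM n f k :
  coefs (fpsX R ^+ n * f) k = if (k < n)%N then 0 else coefs f (k - n).
Proof.
elim: n k => [|n IHn] k; first by rewrite mul1r subn0.
by rewrite exprS -mulrA coefsXM; case: k.
Qed.

Lemma eqX_Xn K n : (K <= n)%N -> eqX K (fpsX R ^+ n) 0.
Proof.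
move=> Kn j jK; rewrite -[fpsX R ^+ n]mulr1 coefsXnM.
by rewrite (leq_trans jK Kn).
Qed.

Lemma coefs0_Xn n : (0 < n)%N -> coefs (fpsX R ^+ n) 0 = 0.
Proof. by move=> n0; rewrite (@eqX_Xn 1 n). Qed.

Lemma eqX_qpoch K n f q : coefs f 0 = 0 -> coefs q 0 = 0 -> (K <= n)%N ->
  eqX K (\prod_(i < n) (1 - f * q ^+ i)) (qpoch f q).
Proof.
move=> f0 q0 Kn j jK; rewrite -(coefs_qpoch f0 q0 (ltnW (leq_trans jK Kn))).
rewrite big_add1 big_mkord; congr (coefs _ _).
by apply: eq_bigr => i _; rewrite subn1.
Qed.

Lemma qfactE (q : fps R) n : qfact q n = \prod_(i < n) (1 - q * q ^+ i).
Proof. by apply: eq_bigr => i _; rewrite exprS. Qed.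

Lemma eqX_qfact K n q : coefs q 0 = 0 -> (K <= n)%N ->
  eqX K (qfact q n) (qpoch q q).
Proof. by move=> q0 Kn; rewrite qfactE; apply: eqX_qpoch. Qed.

(** By [gbin_qfact] the binomial is one q-factorial over two others; all three agree with (q;q)_oo
    modulo X^K because M, k and M - k are at least K. *)
Lemma eqX_gbin K M k q : coefs q 0 = 0 -> (K <= k)%N -> (k + K <= M)%N ->
  eqX K (qpoch q q * gbin q M k) 1.
Proof.
move=> q0 Kk kM; apply: (@eqX_mul2l _ (qpoch q q)); first exact: qpoch_unit.
rewrite mulr1 mulrC -mulrA mulrCA mulrA.
have Mk : (k <= M)%N by lia.
have := gbin_qfact q Mk => e.
have e1 : eqX K (gbin q M k * qpoch q q * qpoch q q)
   (gbin q M k * qfact q k * qfact q (M - k)).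
  by apply: eqXM; [apply: eqXM|] => //; apply/eqX_sym/eqX_qfact => //; lia.
apply: eqX_trans e1 _; rewrite e; apply: eqX_qfact => //; lia.
Qed.

Section Limit.
Variables (p r : fps R) (t : int -> fps R) (K : nat).
Hypothesis pr0 : coefs (p * r) 0 = 0.
Hypothesis t_small : forall j : int, (K < `|j|)%N -> eqX K (t j) 0.

(** A term with |j| > K vanishes modulo X^K on both sides. For |j| <= K the bound on N keeps N + j
    and N - j at least K, so [eqX_gbin] applies. *)
Lemma eqX_theta c N : (2 * K.+1 <= N)%N ->
  eqX K (qpoch (p * r) (p * r) * theta p r t c N N)
    (\sum_(k < (N + N).+1) (c (k%:Z - N%:Z))%:~R * t (k%:Z - N%:Z)).
Proof.
move=> KN; rewrite /theta mulr_sumr; apply: eqX_sum => k _.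
have [Kj|jK] := ltnP K `|k%:Z - N%:Z|.
  apply: (@eqX_trans _ 0).
    rewrite -[0](mulr0 (qpoch (p * r) (p * r))); apply: eqXM => //.
    rewrite -[0](mul0r (gbin (p * r) (N + N) k)); apply: eqXM => //.
    rewrite -[0](mulr0 (c (k%:Z - N%:Z))%:~R); apply: eqXM => //.
    exact: t_small.
  apply: eqX_sym; rewrite -[0](mulr0 (c (k%:Z - N%:Z))%:~R).
  by apply: eqXM => //; exact: t_small.
rewrite mulrCA -[X in eqX _ _ X]mulr1; apply: eqXM => //.
apply: eqX_gbin => //; have := ltn_ord k; lia.
Qed.
End Limit.
End Truncation.

Lemma big_zrange_sym (V : zmodType) (F : int -> V) (N : nat) :
  \sum_(j <- zrange (- N%:Z) N%:Z) F j = \sum_(k < (N + N).+1) F (k%:Z - N%:Z).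
Proof.
rewrite /zrange; case: ifPn => [_|]; last by lia.
rewrite big_map; have -> : `|N%:Z - - N%:Z|%N = (N + N)%N by lia.
rewrite -[X in iota 0 X]subn0 -/(index_iota 0 _) big_mkord.
by apply: eq_bigr => i _; rewrite addrC.
Qed.

(** * Theta series with quadratic exponents *)

Section ClassicalTheta.
Variables b g : nat.
Local Notation X := (fpsX int).
Local Notation p := (- X ^+ (2 * b + g)).
Local Notation r := (- X ^+ g).
Local Notation q := (X ^+ (2 * (b + g))).

(** The pairs (b, g) used below are (1, 0) for Jacobi's series, (0, 2) for Gauss's and (2, 4) for
    Euler's pentagonal series in X^4. *)
Definition qterm (j : int) : fps int :=
  (-1) ^+ `|j|%N * X ^+ absz (b%:Z * (j ^+ 2 + j) + g%:Z * j ^+ 2).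

Lemma qterm_expE (j : int) :
  absz (b%:Z * (j ^+ 2 + j) + g%:Z * j ^+ 2) =
  b%:Z * (j ^+ 2 + j) + g%:Z * j ^+ 2 :> int.
Proof.
have jj : 0 <= j ^+ 2 + j by nia.
by rewrite gez0_abs // addr_ge0 // mulr_ge0 // sqr_ge0.
Qed.

Lemma qterm_base : p * r = q.
Proof. by rewrite mulrNN -exprD; congr (_ ^+ _); lia. Qed.

Lemma qterm0 : qterm 0 = 1.
Proof.
rewrite /qterm mul1r.
by have -> : absz (b%:Z * (0 ^+ 2 + 0) + g%:Z * 0 ^+ 2) = 0%N by lia.
Qed.

Lemma qtermS (n : nat) : qterm n.+1%:Z = qterm n%:Z * (p * (p * r) ^+ n).
Proof.
rewrite qterm_base /qterm [(-1) ^+ _]exprS -exprM.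
have -> : absz (b%:Z * (n.+1%:Z ^+ 2 + n.+1%:Z) + g%:Z * n.+1%:Z ^+ 2) =
  (absz (b%:Z * (n%:Z ^+ 2 + n%:Z) + g%:Z * n%:Z ^+ 2)%R + (2 * b + g) + 2 * (b + g) * n)%N.
  have := qterm_expE n.+1%:Z; have := qterm_expE n%:Z.
  by move: (absz _) (absz _) => e e'; nia.
by rewrite !exprD; ring.
Qed.

Lemma qtermN (n : nat) :
  qterm (- n.+1%:Z) = qterm (- n%:Z) * (r * (p * r) ^+ n).
Proof.
rewrite qterm_base /qterm !abszN [(-1) ^+ _]exprS -exprM.
have -> : absz (b%:Z * ((- n.+1%:Z) ^+ 2 + (- n.+1%:Z)) + g%:Z * (- n.+1%:Z) ^+ 2) =
  (absz (b%:Z * ((- n%:Z) ^+ 2 + (- n%:Z)) + g%:Z * (- n%:Z) ^+ 2)%R + g + 2 * (b + g) * n)%N.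
  have := qterm_expE (- n.+1%:Z); have := qterm_expE (- n%:Z).
  by move: (absz _) (absz _) => e e'; nia.
by rewrite !exprD; ring.
Qed.

Lemma qterm_small K (j : int) : (0 < b + g)%N -> (K < `|j|)%N ->
  eqX K (qterm j) 0.
Proof.
move=> bg Kj; rewrite /qterm -[0](mulr0 ((-1) ^+ `|j|%N)); apply: eqXM => //.
by apply: eqX_Xn; nia.
Qed.

Lemma qterm_sum (c : int -> int) K N : (0 < b + g)%N -> (2 * K.+1 <= N)%N ->
  eqX K (qpoch q q * theta p r qterm c N N)
    (\sum_(j <- zrange (- N%:Z) N%:Z) (c j)%:~R * qterm j).
Proof.
move=> bg KN; rewrite big_zrange_sym -qterm_base; apply: eqX_theta => //.
  by rewrite qterm_base coefs0_Xn //; lia.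
by move=> j; apply: qterm_small.
Qed.

Lemma triple_product K N : (0 < g)%N -> (2 * K.+1 <= N)%N ->
  eqX K (\sum_(j <- zrange (- N%:Z) N%:Z) qterm j)
    (qpoch q q * qpoch (X ^+ (2 * b + g)) q * qpoch (X ^+ g) q).
Proof.
move=> g0 KN; have bg : (0 < b + g)%N by lia.
apply: (@eqX_trans _ _ (qpoch q q * theta p r qterm (fun=> 1) N N)).
  apply: eqX_sym; apply: eqX_trans (qterm_sum (fun=> 1) bg KN) _.
  by apply: eqX_sum => j _; rewrite mul1r.
rewrite (theta_one qterm0 qtermS qtermN) qterm_base -mulrA; apply: eqXM => //.
have q0 : coefs q 0 = 0 by rewrite coefs0_Xn //; lia.
apply: eqXM; under eq_bigr do rewrite mulNr; apply: eqX_qpoch => //; try lia.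
  by rewrite coefs0_Xn //; lia.
by rewrite coefs0_Xn.
Qed.

End ClassicalTheta.

(** * Two double sums over lattice points, compared by residues modulo 3 *)

Lemma coefs_intrM (c : int) (f : fps int) k :
  coefs (c%:~R * f) k = c * coefs f k.
Proof.
have nat_case n : coefs (n%:R * f) k = n%:Z * coefs f k.
  elim: n => [|n IHn]; first by rewrite !mul0r.
  by rewrite mulrSr mulrDl mul1r coefsD IHn -[n.+1]addn1 PoszD mulrDl mul1r.
case: c => n; first exact: nat_case.
by rewrite NegzE mulrNz !mulNr coefsN nat_case.
Qed.

Lemma coefs_monomial (c : int) n k :
  coefs (c%:~R * fpsX int ^+ n) k = if n == k then c else 0.
Proof.
rewrite coefs_intrM -[fpsX int ^+ n]mulr1 coefsXnM coefs1.
case: ltngtP => [|nk|->]; rewrite ?mulr0 // ?subnn ?mulr1 //.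
by rewrite subn_eq0 leqNgt nk mulr0.
Qed.

Definition sg (j : int) : int := (-1) ^+ absz j.

Lemma sgD i j : sg (i + j) = sg i * sg j.
Proof.
rewrite /sg -exprD -signr_odd -[in RHS]signr_odd; congr (_ ^+ nat_of_bool _).
by lia.
Qed.

Lemma sgN j : sg (- j) = sg j. Proof. by rewrite /sg abszN. Qed.

Lemma sgM2 j : sg (2 * j) = 1.
Proof.
rewrite /sg -signr_odd; have -> : odd (absz (2 * j)) = false by lia.
by [].
Qed.

Definition box (N : nat) : seq (int * int) :=
  [seq (i, j) | i <- zrange (- N%:Z) N%:Z, j <- zrange (- N%:Z) N%:Z].

Lemma box_uniq N : uniq (box N).
Proof. by apply: allpairs_uniq; rewrite ?zrange_uniq // => -[? ?] [? ?]. Qed.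

Lemma mem_box N p :
  (p \in box N) = (- N%:Z <= p.1 <= N%:Z) && (- N%:Z <= p.2 <= N%:Z).
Proof.
case: p => i j; apply/allpairsP/andP => [[[i' j'] /= [+ + [-> ->]]]|[]].
  by rewrite !mem_zrange.
by move=> ? ?; exists (i, j); rewrite !mem_zrange.
Qed.

(* The exponents and coefficients of the double sums obtained from
   sum_i (-1)^i q^(2i^2) * sum_j (-1)^j (2j+1+4i) q^(j^2+j) and from
   sum_n (6n+1) q^(3n^2+n) * sum_m (-1)^m q^(6m^2+2m). *)
Definition gj_exp (p : int * int) : int := p.2 ^+ 2 + p.2 + 2 * p.1 ^+ 2.
Definition gj_coef (p : int * int) : int :=
  (2 * p.2 + 1 + 4 * p.1) * sg (p.1 + p.2).
Definition se_exp (p : int * int) : int :=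
  3 * p.1 ^+ 2 + p.1 + 6 * p.2 ^+ 2 + 2 * p.2.
Definition se_coef (p : int * int) : int := (6 * p.1 + 1) * sg p.2.

Section Lattice.
Variables N d : nat.
Hypothesis dN : (d < N)%N.

Local Notation L1 := ([seq p <- box N | gj_exp p == d%:Z]).
Local Notation L2 := ([seq p <- box N | se_exp p == d%:Z]).

(** Since d < N, every integer solution already lies in the box, so the bijections below need no
    check of ranges. *)
Lemma mem_L1 p : (p \in L1) = (gj_exp p == d%:Z).
Proof.
rewrite mem_filter mem_box andb_idr // => /eqP; case: p => i j; rewrite /gj_exp /=.
have : 0 <= j ^+ 2 + j by nia.
have : 0 <= (j + 1) ^+ 2 by exact: sqr_ge0.
have : i <= i ^+ 2 by nia.
have : - i <= i ^+ 2 by nia.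
have := dN; have := sqr_ge0 j; have := sqr_ge0 i => /=; lia.
Qed.

Lemma mem_L2 p : (p \in L2) = (se_exp p == d%:Z).
Proof.
rewrite mem_filter mem_box andb_idr // => /eqP; case: p => i j; rewrite /se_exp /=.
have : 0 <= 3 * i ^+ 2 + i by nia.
have : 0 <= 6 * j ^+ 2 + 2 * j by nia.
have : - i <= 3 * i ^+ 2 + i by nia.
have : - j <= 6 * j ^+ 2 + 2 * j by nia.
have := dN; have := sqr_ge0 j; have := sqr_ge0 i => /=; lia.
Qed.

Definition diff_mod3 (r : int) (p : int * int) := ((p.2 - p.1) %% 3)%Z == r.

(** The substitution i = n - m, j = n + 2m maps Z^2 bijectively onto the pairs with j - i divisible
    by 3 and matches exponents and coefficients. *)
Lemma sum_diff_0 : \sum_(p <- L1 | diff_mod3 0 p) gj_coef p = \sum_(p <- L2) se_coef p.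
Proof.
pose phi (p : int * int) : int * int := (p.1 - p.2, p.1 + 2 * p.2).
rewrite -big_filter (perm_big (map phi L2)) ?big_map.
  apply: eq_bigr => -[n m] _; rewrite /gj_coef /se_coef /phi /=.
  have -> : n - m + (n + 2 * m) = 2 * n + m by ring.
  by rewrite sgD sgM2; ring.
apply: uniq_perm; rewrite ?map_inj_in_uniq ?filter_uniq ?box_uniq //.
  by move=> [n m] [n' m'] _ _ [] *; congr pair; lia.
move=> [i j]; rewrite mem_filter mem_L1; apply/andP/mapP => [[ci Qi]|].
  exists (i + ((j - i) %/ 3)%Z, ((j - i) %/ 3)%Z); last first.
    by move: ci; rewrite /diff_mod3 /phi /= => /eqP ci; congr pair; lia.
  have [m jE] : exists m, j - i = 3 * m.
    by exists ((j - i) %/ 3)%Z; move: ci; rewrite /diff_mod3 /=; lia.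
  rewrite mem_L2; move: Qi; rewrite /gj_exp /se_exp /= jE mulKz //.
  have -> : j = i + 3 * m by lia.
  by lia.
case=> -[n m]; rewrite mem_L2 => /eqP Qn [-> ->]; rewrite /diff_mod3 /gj_exp /=.
split; first by lia.
by rewrite -Qn /se_exp /=; apply/eqP; ring.
Qed.

(** The symmetry (i, j) -> (-i, -1 - j) preserves exponent and coefficient and carries residue 0 to
    residue 2; [phi] is the substitution for residue 0 followed by it. *)
Lemma sum_diff_2 : \sum_(p <- L1 | diff_mod3 2 p) gj_coef p = \sum_(p <- L2) se_coef p.
Proof.
pose phi (p : int * int) : int * int := (p.2 - p.1, - 1 - p.1 - 2 * p.2).
rewrite -big_filter (perm_big (map phi L2)) ?big_map.
  apply: eq_bigr => -[n m] _; rewrite /gj_coef /se_coef /phi /=.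
  have -> : m - n + (- 1 - n - 2 * m) = - (2 * n + m + 1) by ring.
  by rewrite sgN !sgD sgM2 /sg expr1; ring.
apply: uniq_perm; rewrite ?map_inj_in_uniq ?filter_uniq ?box_uniq //.
  by move=> [n m] [n' m'] _ _ [] *; congr pair; lia.
move=> [i j]; rewrite mem_filter mem_L1; apply/andP/mapP => [[ci Qi]|].
  have [m jE] : exists m, j = i - 1 - 3 * m.
    by exists (- (((j - i + 1)) %/ 3)%Z); move: ci; rewrite /diff_mod3 /=; lia.
  exists (m - i, m); last by rewrite /phi /=; congr pair; lia.
  by rewrite mem_L2; move: Qi; rewrite /gj_exp /se_exp /= jE; lia.
case=> -[n m]; rewrite mem_L2 => /eqP Qn [-> ->]; rewrite /diff_mod3 /gj_exp /=.
split; first by lia.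
by rewrite -Qn /se_exp /=; apply/eqP; ring.
Qed.

(* In the coordinates N = 2j+1+4i, M = 2j+1-2i, where the exponent is
   (N^2 + 2 M^2 - 3) / 12, this is the reflection N -> -N. *)
Lemma sum_diff_1 : \sum_(p <- L1 | diff_mod3 1 p) gj_coef p = 0.
Proof.
(* Solving for the reflected point gives i' = -(2j + 1 + i)/3 and j' = j - i + i'; the division is
   exact when j - i is 1 modulo 3. *)
pose t (p : int * int) := ((2 * p.2 + 1 + p.1) %/ 3)%Z.
pose psi (p : int * int) : int * int := (- t p, p.2 - p.1 - t p).
have tE p : diff_mod3 1 p -> 3 * t p = 2 * p.2 + 1 + p.1.
  by rewrite /diff_mod3 /t; lia.
have cls_psi p : diff_mod3 1 p -> diff_mod3 1 (psi p).
  by move=> cp; have := tE _ cp; move: cp; rewrite /diff_mod3 /psi /=; lia.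
have psiK p : diff_mod3 1 p -> psi (psi p) = p.
  case: p => i j cp; have := tE _ (cls_psi _ cp); have := tE _ cp.
  by rewrite {3 4}/psi /=; move: (t _) (t _) => s s' e e'; congr pair; lia.
have Q_psi p : diff_mod3 1 p -> gj_exp (psi p) = gj_exp p.
  move=> /tE; case: p => i j; rewrite /gj_exp /psi /=; move: (t _) => s e.
  have -> : i = 3 * s - 2 * j - 1 by lia.
  by ring.
have w_psi p : diff_mod3 1 p -> gj_coef (psi p) = - gj_coef p.
  move=> /tE; case: p => i j; rewrite /gj_coef /psi /=; move: (t _) => s e.
  have -> : - s + (j - i - s) = (i + j) + 2 * - (s + i) by ring.
  rewrite sgD sgM2 mulr1 -mulNr; congr (_ * _).
  have -> : i = 3 * s - 2 * j - 1 by lia.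
  by ring.
have : \sum_(p <- L1 | diff_mod3 1 p) gj_coef p = - \sum_(p <- L1 | diff_mod3 1 p) gj_coef p.
  rewrite -big_filter {1}(perm_big (map psi (filter (diff_mod3 1) L1))).
    rewrite big_map -sumrN big_filter [RHS]big_filter.
    by apply: eq_bigr => p /w_psi.
  apply: uniq_perm; rewrite ?map_inj_in_uniq ?filter_uniq ?box_uniq //.
  - move=> p p'; rewrite !mem_filter => /andP[cp _] /andP[cp' _] e.
    by rewrite -(psiK p) // e psiK.
  move=> p; rewrite mem_filter mem_L1; apply/andP/mapP => [[cp Qp]|].
    by exists (psi p); rewrite ?psiK // mem_filter cls_psi //= mem_L1 Q_psi.
  by case=> p'; rewrite mem_filter mem_L1 => /andP[cp Qp] ->; rewrite cls_psi ?Q_psi.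
by lia.
Qed.

Lemma lattice_sum :
  \sum_(p <- box N | gj_exp p == d%:Z) gj_coef p =
  2 * \sum_(p <- box N | se_exp p == d%:Z) se_coef p.
Proof.
rewrite -big_filter -[in RHS]big_filter.
rewrite (bigID (diff_mod3 0)) /= sum_diff_0 [X in _ + X = _](bigID (diff_mod3 1)) /=.
rewrite [X in _ + (X + _) = _](eq_bigl (diff_mod3 1)); last by move=> p; rewrite /diff_mod3; apply/idP/idP; lia.
rewrite sum_diff_1 add0r [X in _ + X = _](eq_bigl (diff_mod3 2)) ?sum_diff_2; last first.
  by move=> p; rewrite /diff_mod3; apply/idP/idP; lia.
by ring.
Qed.
End Lattice.

Lemma gj_exp_ge0 p : 0 <= gj_exp p.
Proof. by case: p => i j; rewrite /gj_exp /=; nia. Qed.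

Lemma se_exp_ge0 p : 0 <= se_exp p.
Proof.
case: p => n m; rewrite /se_exp /=.
have : 0 <= 3 * n ^+ 2 + n by nia.
have : 0 <= 6 * m ^+ 2 + 2 * m by nia.
by lia.
Qed.

Lemma eqX_box (e1 e2 w1 w2 : int * int -> int) N K :
  (forall p, 0 <= e1 p) -> (forall p, 0 <= e2 p) ->
  (forall d : nat, (d < K)%N -> \sum_(p <- box N | e1 p == d%:Z) w1 p =
     2 * \sum_(p <- box N | e2 p == d%:Z) w2 p) ->
  eqX K (\sum_(p <- box N) (w1 p)%:~R * fpsX int ^+ absz (e1 p))
    (2 * \sum_(p <- box N) (w2 p)%:~R * fpsX int ^+ absz (e2 p)).
Proof.
have coefE (e w : int * int -> int) d : (forall p, 0 <= e p) ->
    coefs (\sum_(p <- box N) (w p)%:~R * fpsX int ^+ absz (e p)) d =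
    \sum_(p <- box N | e p == d%:Z) w p.
  move=> e0; rewrite coefs_sum [RHS]big_mkcond; apply: eq_bigr => p _.
  by rewrite coefs_monomial -eqz_nat gez0_abs.
move=> e10 e20 eqd d dK.
by rewrite coefE // eqd // -(coefE _ _ _ e20) -[2 in RHS]/(2%:~R) coefs_intrM.
Qed.

Lemma big_box (V : nmodType) (F : int -> int -> V) N :
  \sum_(p <- box N) F p.1 p.2 =
  \sum_(i <- zrange (- N%:Z) N%:Z) \sum_(j <- zrange (- N%:Z) N%:Z) F i j.
Proof. by rewrite /box big_allpairs. Qed.

(** * Truncated theta series and the product formula *)

Definition jsum N := \sum_(j <- zrange (- N%:Z) N%:Z) j%:~R * qterm 1 0 j.
Definition jsum0 N := \sum_(j <- zrange (- N%:Z) N%:Z) qterm 1 0 j.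
Definition gsum N := \sum_(i <- zrange (- N%:Z) N%:Z) qterm 0 2 i.
Definition gsum4 N :=
  \sum_(i <- zrange (- N%:Z) N%:Z) (1 + 4 * i)%:~R * qterm 0 2 i.
Definition esum N := \sum_(m <- zrange (- N%:Z) N%:Z) qterm 2 4 m.
Definition ssum N :=
  \sum_(n <- zrange (- N%:Z) N%:Z) (6 * n + 1)%:~R * fpsX int ^+ texp n.

Lemma sg_intr j : (-1) ^+ absz j = (sg j)%:~R :> fps int.
Proof. by rewrite /sg rmorphXn rmorphN1. Qed.

(** Writing 2j + 1 + 4i as 2j + (1 + 4i) isolates a product with the factor [jsum0], which tends to
    0. *)
Lemma gj_sum N :
  \sum_(p <- box N) (gj_coef p)%:~R * fpsX int ^+ absz (gj_exp p) =
  2 * (gsum N * jsum N) + gsum4 N * jsum0 N.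
Proof.
rewrite /gsum /jsum /gsum4 /jsum0 !big_distrlr /= mulr_sumr -big_split /=.
rewrite (big_box (fun i j => (gj_coef (i, j))%:~R * fpsX int ^+ absz (gj_exp (i, j)))).
apply: eq_bigr => i _; rewrite mulr_sumr -big_split /=; apply: eq_bigr => j _.
rewrite /qterm !sg_intr /gj_coef sgD /=.
have -> : absz (gj_exp (i, j)) = (absz (0%:Z * (i ^+ 2 + i) + 2%:Z * i ^+ 2)%R +
    absz (1%:Z * (j ^+ 2 + j) + 0%:Z * j ^+ 2)%R)%N.
  have i0 := sqr_ge0 i; have j0 : 0 <= j ^+ 2 + j by nia.
  by rewrite /gj_exp /=; lia.
by rewrite exprD !(rmorphD, rmorphM, rmorph1) /=; ring.
Qed.

Lemma se_sum N :
  \sum_(p <- box N) (se_coef p)%:~R * fpsX int ^+ absz (se_exp p) =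
  ssum N * esum N.
Proof.
rewrite /ssum /esum !big_distrlr /=.
rewrite (big_box (fun i j => (se_coef (i, j))%:~R * fpsX int ^+ absz (se_exp (i, j)))).
apply: eq_bigr => n _; apply: eq_bigr => m _.
rewrite /qterm !sg_intr /se_coef /=.
have -> : absz (se_exp (n, m)) =
    (texp n + absz (2%:Z * (m ^+ 2 + m) + 4%:Z * m ^+ 2)%R)%N.
  have n0 : 0 <= 3 * n ^+ 2 + n by nia.
  have m0 : 0 <= 6 * m ^+ 2 + 2 * m by nia.
  by rewrite /se_exp /texp /=; lia.
by rewrite exprD !(rmorphD, rmorphM, rmorph1) /=; ring.
Qed.

Section ProductFormula.
Variables K N : nat.
Hypothesis KN : (2 * K.+1 <= N)%N.
Local Notation X := (fpsX int).

Lemma jsum0_lim : eqX K (jsum0 N) 0.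
Proof.
have := @qterm_sum 1 0 (fun=> 1) K N isT KN.
rewrite (theta_one (qterm0 1 0) (qtermS 1 0) (qtermN 1 0)).
(* Here r = -X^0 = -1, so the factor at i = 0 vanishes. *)
have -> : \prod_(i < N) (1 + - X ^+ 0 * (- X ^+ (2 * 1 + 0) * - X ^+ 0) ^+ i) = 0.
  case: N KN => // N' _.
  by rewrite big_ord_recl /= !expr0 mulr1 subrr mul0r.
rewrite !mulr0 => e; apply/eqX_sym; apply: eqX_trans e _.
by apply: eqX_sum => j _; rewrite mul1r.
Qed.

(** One factor (q^2;q^2)_oo comes from the limit of the Gaussian binomials, the other two from the
    products in [theta_id]. *)
Lemma jsum_lim : eqX K (jsum N) (qpoch (X ^+ 2) (X ^+ 2) ^+ 3).
Proof.
have NE : N = N.-1.+1 by lia.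
have q0 : coefs (X ^+ 2) 0 = 0 by rewrite coefs0_Xn.
have := @qterm_sum 1 0 id K N isT KN.
rewrite [in theta _ _ _ _ _ _]NE.
rewrite (theta_id (qterm0 1 0) (qtermS 1 0) (qtermN 1 0)) ?expr0 //.
rewrite (qterm_base 1 0) /= => /eqX_sym e; apply: eqX_trans e _.
rewrite exprS; apply: eqXM => //; rewrite expr2; apply: eqXM.
  under eq_bigr do rewrite mulNr; apply: eqX_qpoch => //; lia.
under eq_bigr do rewrite mulNr mul1r exprS; apply: eqX_qpoch => //; lia.
Qed.

Lemma gsum_lim :
  eqX K (gsum N) (qpoch (X ^+ 4) (X ^+ 4) * qpoch (X ^+ 2) (X ^+ 4) ^+ 2).
Proof. by rewrite expr2 mulrA; apply: (@triple_product 0 2 K N isT KN). Qed.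

(** Sorts the exponents i + 1 by residue modulo 3; at y = X^4 this merges the three products of base
    X^12 given by [triple_product]. *)
Lemma prod_trisect (R : comNzRingType) (y : R) n :
  \prod_(i < 3 * n) (1 - y * y ^+ i) =
  \prod_(i < n) (1 - y ^+ 3 * y ^+ 3 ^+ i) *
  \prod_(i < n) (1 - y ^+ 2 * y ^+ 3 ^+ i) *
  \prod_(i < n) (1 - y * y ^+ 3 ^+ i).
Proof.
elim: n => [|n IHn]; first by rewrite muln0 !big_ord0 !mulr1.
have -> : (3 * n.+1)%N = (3 * n).+3 by lia.
rewrite !(big_ord_recr (3 * n).+2, big_ord_recr (3 * n).+1) /=.
rewrite !big_ord_recr /= IHn [y ^+ (3 * n).+2]exprS [y ^+ (3 * n).+1]exprS exprM.
by ring.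
Qed.

Lemma esum_lim : eqX K (esum N) (qpoch (X ^+ 4) (X ^+ 4)).
Proof.
apply: eqX_trans (@triple_product 2 4 K N isT KN) _.
have c0 n : (0 < n)%N -> coefs (X ^+ n) 0 = 0 by exact: coefs0_Xn.
have KN' : (K <= N)%N by lia.
have := prod_trisect (X ^+ 4) N; rewrite -!exprM => tri.
apply/eqX_sym; apply: (@eqX_trans _ _ (\prod_(i < 3 * N) (1 - X ^+ 4 * X ^+ 4 ^+ i))).
  by apply/eqX_sym/eqX_qpoch; rewrite ?c0 //; lia.
by rewrite tri; apply: eqXM; [apply: eqXM|]; apply: eqX_qpoch => //; exact: c0.
Qed.

(** The limits of [gsum] and [esum] share the factor (q^4;q^4)_oo; cancelling it leaves the
    denominator. *)
Lemma ssum_lim : eqX K (ssum N)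
  (qpoch (X ^+ 2) (X ^+ 2) ^+ 3 * qpoch (X ^+ 2) (X ^+ 4) ^+ 2).
Proof.
have KN' : (K <= N)%N by lia.
have := eqX_box gj_exp_ge0 se_exp_ge0
  (fun d dK => lattice_sum (leq_trans dK KN')).
rewrite gj_sum se_sum => D.
have D' : eqX K (2 * (gsum N * jsum N)) (2 * (ssum N * esum N)).
  apply: eqX_trans D; apply: eqX_sym.
  rewrite -[X in eqX _ _ X]addr0 -[X in eqX _ _ (_ + X)](mulr0 (gsum4 N)).
  by apply: eqXD => //; apply: eqXM => //; exact: jsum0_lim.
(* 2 is not a unit over the integers, so it is cancelled coefficient by coefficient. *)
have {}D' : eqX K (gsum N * jsum N) (ssum N * esum N).
  move=> d /D'.
  by rewrite -[2]/(2%:~R) !coefs_intrM => /(mulfI (_ : 2 != 0 :> int)); apply.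
apply: (@eqX_mul2l _ _ (qpoch (X ^+ 4) (X ^+ 4))); first exact: qpoch_unit.
apply: (@eqX_trans _ _ (ssum N * esum N)).
  by rewrite mulrC; apply: eqXM => //; apply/eqX_sym/esum_lim.
apply: eqX_trans (eqX_sym D') _.
have mulrAC' (f g h : fps int) : f * (g * h) = f * h * g.
  by rewrite mulrA mulrAC.
by rewrite mulrAC'; exact: eqXM gsum_lim jsum_lim.
Qed.

End ProductFormula.

(** * Inverses with non-negative coefficients *)

Definition nneg (f : fps int) := forall k, 0 <= coefs f k.

Lemma nneg1 : nneg 1. Proof. by case. Qed.

Lemma coefsM_ge0 f g k : nneg f -> (forall j, (j <= k)%N -> 0 <= coefs g j) ->
  0 <= coefs (f * g) k.
Proof.
move=> f0 g0; rewrite coefsM sumr_ge0 // => i _.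
by rewrite mulr_ge0 ?g0 // leq_subr.
Qed.

Lemma nnegM f g : nneg f -> nneg g -> nneg (f * g).
Proof. by move=> f0 g0 k; apply: coefsM_ge0. Qed.

Lemma nneg_exp f n : nneg f -> nneg (f ^+ n).
Proof.
move=> f0; elim: n => [|n IHn]; first exact: nneg1.
by rewrite exprS; apply: nnegM.
Qed.

Lemma eqX_inv (R : comUnitRingType) K (f g : fps R) :
  f \is a GRing.unit -> g \is a GRing.unit -> eqX K f g -> eqX K f^-1 g^-1.
Proof.
move=> uf ug fg; apply: (eqX_mul2l uf); rewrite divrr //.
by rewrite -[1](divrr ug); apply: eqXM => //; apply: eqX_sym.
Qed.

Lemma unit_subXn (R : comUnitRingType) n : (0 < n)%N ->
  1 - fpsX R ^+ n \is a GRing.unit.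
Proof. by move=> n0; rewrite fps_unitE coefsB coefs0_Xn // subr0 unitr1. Qed.

(** The inverse satisfies h = 1 + X^n h, which settles the signs by strong induction on the
    index. *)
Lemma nneg_inv_subXn n : (0 < n)%N -> nneg (1 - fpsX int ^+ n)^-1.
Proof.
move=> n0; set h := (_ - _)^-1.
have hE : h = 1 + fpsX int ^+ n * h.
  have : (1 - fpsX int ^+ n) * h = 1 by rewrite /h divrr // unit_subXn.
  by rewrite mulrBl mul1r => /eqP; rewrite subr_eq => /eqP.
move=> k; have [m] := ubnP k; elim: m k => // m IHm k km.
rewrite hE coefsD coefsXnM addr_ge0 ?nneg1 //; case: ltnP => // nk.
by apply: IHm; lia.
Qed.

(** Modulo X^(k+1) the infinite product is finite, and the inverse of a finite one is a product of
    geometric series. *)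
Lemma nneg_inv_qpoch m n : (0 < m)%N -> (0 < n)%N ->
  nneg (qpoch (fpsX int ^+ m) (fpsX int ^+ n))^-1.
Proof.
move=> m0 n0 k; pose p l := \prod_(i < l) (1 - fpsX int ^+ m * fpsX int ^+ n ^+ i).
have pS l : p l.+1 = p l * (1 - fpsX int ^+ (m + n * l)).
  by rewrite /p big_ord_recr /= -exprM exprD.
have up l : p l \is a GRing.unit.
  elim: l => [|l IHl]; first by rewrite /p big_ord0 unitr1.
  by rewrite pS unitrMl // unit_subXn //; lia.
have p0 l : nneg (p l)^-1.
  elim: l => [|l IHl]; first by rewrite /p big_ord0 invr1; exact: nneg1.
  rewrite pS invrM // ?unit_subXn //; last by lia.
  by apply: nnegM => //; apply: nneg_inv_subXn; lia.
have e : eqX k.+1 (qpoch (fpsX int ^+ m) (fpsX int ^+ n)) (p k.+1).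
  by apply/eqX_sym/eqX_qpoch; rewrite ?coefs0_Xn.
rewrite (eqX_inv (qpoch_unit _ _) (up _) e) //; exact: p0.
Qed.

Lemma qpochS (f q : fps int) : coefs f 0 = 0 -> coefs q 0 = 0 ->
  qpoch f q = (1 - f) * qpoch (f * q) q.
Proof.
move=> f0 q0; apply: fpsP => k.
rewrite -(eqX_qpoch f0 q0 (leqnSn k.+1)) // big_ord_recl expr0 mulr1.
apply: (@eqXM _ k.+1) => //.
under eq_bigr => i _ do rewrite lift0 exprS mulrA.
by apply: eqX_qpoch => //; rewrite coefsM0 f0 mul0r.
Qed.

(** * The denominator and its factor (1 - q^2)^2 *)

Definition den : fps int :=
  qpoch (fpsX int ^+ 2) (fpsX int ^+ 2) ^+ 3 *
  qpoch (fpsX int ^+ 2) (fpsX int ^+ 4) ^+ 2.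

Lemma den_unit : den \is a GRing.unit.
Proof. by rewrite unitrM !unitrX ?qpoch_unit. Qed.

(** The series 2 / (1 - q^2)^2; the numerator 2 turns k/2 + 1 into k + 2. *)
Definition ramp : fps int := Fps (fun k => if odd k then 0 else k%:Z + 2).

Lemma coefs_ramp k : coefs ramp k = if odd k then 0 else k%:Z + 2.
Proof. by []. Qed.

Lemma coefs_subX2M (f : fps int) k : coefs ((1 - fpsX int ^+ 2) * f) k =
  coefs f k - if (k < 2)%N then 0 else coefs f (k - 2).
Proof. by rewrite mulrBl mul1r coefsB coefsXnM. Qed.

Lemma rampE : (1 - fpsX int ^+ 2) ^+ 2 * ramp = 2.
Proof.
apply: fpsP => k; rewrite -[2 in RHS]mulr1 -[2 in RHS]/(2%:~R) coefs_intrM.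
rewrite expr2 -mulrA !coefs_subX2M !coefs_ramp coefs1.
case: k => [|[|[|[|k]]]] //; rewrite !subSS !subn0 /= !negbK.
by case: odd => //; lia.
Qed.

(** Two of the three copies of (q^2;q^2)_oo give up their first factor 1 - q^2 to form the ramp; all
    that remains has a non-negative inverse. *)
Lemma inv_den : exists2 f, nneg f & 2 * den^-1 = f * ramp.
Proof.
set A := qpoch (fpsX int ^+ 2) (fpsX int ^+ 2).
set B := qpoch (fpsX int ^+ 2 * fpsX int ^+ 2) (fpsX int ^+ 2).
set C := qpoch (fpsX int ^+ 2) (fpsX int ^+ 4).
have AE : A = (1 - fpsX int ^+ 2) * B by apply: qpochS; rewrite coefs0_Xn.
have [uA uB uC] : [/\ A \is a GRing.unit, B \is a GRing.unit &
  C \is a GRing.unit] by split; exact: qpoch_unit.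
have nA : nneg A^-1 by exact: nneg_inv_qpoch.
have nB : nneg B^-1 by rewrite /B -exprD; exact: nneg_inv_qpoch.
have nC : nneg C^-1 by exact: nneg_inv_qpoch.
exists (A^-1 * B^-1 ^+ 2 * C^-1 ^+ 2).
  by apply: nnegM; [apply: nnegM => //|]; exact: nneg_exp.
have denE : den = A * (A ^+ 2) * C ^+ 2 by rewrite -exprS.
apply: (mulrI den_unit); rewrite mulrCA divrr ?den_unit // mulr1 -rampE.
move: denE; rewrite {2}AE; move: uA uB uC => {AE nA nB nC}.
move: A B C (1 - _) ramp den => A B C D r d uA uB uC ->.
have EA := divrr uA; have EB := divrr uB; have EC := divrr uC.
transitivity ((A / A) * (B / B) ^+ 2 * (C / C) ^+ 2 * (D ^+ 2 * r)).
  by rewrite EA EB EC !expr1n !mul1r.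
by ring.
Qed.

Lemma odd_texp n : odd (texp n) = false.
Proof.
have even2 (x : int) : odd (absz (2 * x)) = false by lia.
have [m nE] : exists m : int, n = 2 * m \/ n = 2 * m + 1.
  by exists (n %/ 2)%Z; lia.
rewrite /texp; case: nE => ->.
  by rewrite (_ : _ + _ = 2 * (6 * m ^+ 2 + m)) ?even2 //; ring.
by rewrite (_ : 3 * _ + _ = 2 * (6 * m ^+ 2 + 7 * m + 2)) ?even2 //; ring.
Qed.

Definition sterm (n : int) : fps int := (6 * n + 1)%:~R * fpsX int ^+ texp n.

Lemma coefs_ramp_sterm n k : coefs (ramp * sterm n) k =
  if odd k then 0 else (6 * n + 1) * (k.+2 - texp n)%N%:Z.
Proof.
rewrite /sterm mulrCA coefs_intrM mulrC [ramp * _]mulrC coefsXnM coefs_ramp.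
have := odd_texp n; move: (texp n) => e oe.
case: ltnP => [ke|ek].
  case: ifP => ok; rewrite ?mul0r //.
  (* Both k and e are even, so k < e gives k + 2 <= e and the truncated difference is 0. *)
  have -> : (k.+2 - e)%N = 0%N by lia.
  by rewrite mulr0.
rewrite oddB // oe addbF; case: ifP => _; first by rewrite mul0r.
by rewrite mulrC; congr (_ * _); lia.
Qed.

(* Summation by parts: in the ramp coordinate [y = k + 2 - texp m], the partial
   sums of the pairs stay above the defect [- 4 i u_(m+1)], and similarly for
   the other pairing. *)
Lemma even_pair_step (y m i u0 u1 u2 : int) : 0 <= i < m ->
  u0 = Num.max y 0 -> u1 = Num.max (y - (4 * m + 2)) 0 ->
  u2 = Num.max (y - (6 * m + 4)) 0 ->
  0 <= (6 * m + 1) * u0 - (6 * m + 5) * u1 + 4 * (i + 1) * u2 - 4 * i * u0.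
Proof.
move=> /andP[i0 im].
case: (lerP y 0) => y0; case: (lerP (y - (4 * m + 2)) 0) => y1;
  case: (lerP (y - (6 * m + 4)) 0) => y2 -> -> ->; try lia; nia.
Qed.

Lemma odd_pair_step (y m i u0 u1 u2 : int) : 0 <= i -> i + 2 <= m ->
  u0 = Num.max y 0 -> u1 = Num.max (y - 2 * m) 0 ->
  u2 = Num.max (y - (6 * m + 2)) 0 ->
  0 <= (6 * m - 1) * u0 - (6 * m + 1) * u1 + 2 * (i + 1) * u2 - 2 * i * u0.
Proof.
move=> i0 im.
(* When all three maxima are positive, y cancels, and [i + 2 <= m] makes the remaining constant
   non-negative. *)
case: (lerP y 0) => y0; case: (lerP (y - 2 * m) 0) => y1;
  case: (lerP (y - (6 * m + 2)) 0) => y2 -> -> ->; try lia; nia.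
Qed.

(** * Growing a range, and the sign of its tail *)

Lemma big_zrange_recr (V : zmodType) (F : int -> V) a b n : a <= b + 1 ->
  \sum_(i <- zrange a (b + n%:Z)) F i =
  \sum_(i <- zrange a b) F i + \sum_(i < n) F (b + 1 + i%:Z).
Proof.
move=> ab; elim: n => [|n IHn]; first by rewrite big_ord0 !addr0.
rewrite big_ord_recr addrA -IHn addrC -(big_cons _ _ _ _ xpredT).
apply: perm_big; apply: uniq_perm => [||i] /=.
- exact: zrange_uniq.
- by rewrite zrange_uniq mem_zrange andbT; lia.
- by rewrite in_cons !mem_zrange; lia.
Qed.

Lemma big_zrange_recl (V : zmodType) (F : int -> V) a b n : a <= b + 1 ->
  \sum_(i <- zrange (a - n%:Z) b) F i =
  \sum_(i <- zrange a b) F i + \sum_(i < n) F (a - 1 - i%:Z).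
Proof.
move=> ab; elim: n => [|n IHn]; first by rewrite big_ord0 subr0 addr0.
rewrite big_ord_recr addrA -IHn addrC -(big_cons _ _ _ _ xpredT).
apply: perm_big; apply: uniq_perm => [||i] /=.
- exact: zrange_uniq.
- by rewrite zrange_uniq mem_zrange andbT; lia.
- by rewrite in_cons !mem_zrange; lia.
Qed.

(** The terms outside [a, b] are paired by distance, so that each pair is one step of the summation
    by parts. *)
Definition tail (a b : int) (M : nat) : fps int :=
  \sum_(i < M) (sterm (b + 1 + i%:Z) + sterm (a - 1 - i%:Z)).

Lemma big_zrange_grow a b M : a <= b + 1 ->
  \sum_(n <- zrange (a - M%:Z) (b + M%:Z)) sterm n =
  \sum_(n <- zrange a b) sterm n + tail a b M.
Proof.
move=> ab; rewrite big_zrange_recl; last by lia.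
by rewrite big_zrange_recr // -addrA -big_split.
Qed.

Lemma tailS a b M :
  tail a b M.+1 = tail a b M + (sterm (b + 1 + M%:Z) + sterm (a - 1 - M%:Z)).
Proof. by rewrite /tail big_ord_recr. Qed.

Lemma coefs_ramp_odd a b M j : odd j -> coefs (ramp * tail a b M) j = 0.
Proof.
move=> oj; rewrite /tail mulr_sumr coefs_sum big1 // => i _.
by rewrite mulrDr coefsD !coefs_ramp_sterm oj.
Qed.

Lemma even_tail_ge0 (c M j : nat) : (j <= M)%N ->
  0 <= coefs (ramp * tail (- c%:Z - 1) c%:Z M) j.
Proof.
move=> jM; have [oj|ej] := boolP (odd j); first by rewrite coefs_ramp_odd.
pose u n := (j.+2 - texp n)%N%:Z.
have uE n : u n = Num.max (j%:Z + 2 - (3 * n ^+ 2 + n)) 0.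
  by have := texpE n; rewrite /u => <-; case: lerP; lia.
(* The slack 4 L u(m) is borrowed from the next term m = c + 1 + L on the right. At L = M it is 0,
   since M >= j pushes [texp m] beyond j + 2. *)
suff inv L : 0 <= coefs (ramp * tail (- c%:Z - 1) c%:Z L) j
                 + 4 * L%:Z * u (c%:Z + 1 + L%:Z).
  have := inv M; rewrite (_ : u _ = 0) ?mulr0 ?addr0 //.
  have nn : 0 <= (c%:Z + M%:Z) ^+ 2 by exact: sqr_ge0.
  by rewrite uE; case: lerP => //; nia.
elim: L => [|L IHL]; first by rewrite /tail big_ord0 mulr0 coefs0 mulr0 mul0r.
rewrite tailS mulrDr coefsD mulrDr coefsD !coefs_ramp_sterm (negPf ej) -!/(u _).
set m := c%:Z + 1 + L%:Z in IHL *.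
have mE : m = c%:Z + 1 + L%:Z by []; clearbody m.
have -> : - c%:Z - 1 - 1 - L%:Z = - m - 1 by rewrite mE; ring.
have -> : c%:Z + 1 + L.+1%:Z = m + 1 by lia.
have := @even_pair_step (j%:Z + 2 - (3 * m ^+ 2 + m)) m L%:Z (u m)
  (u (- m - 1)) (u (m + 1)).
have -> : 0 <= L%:Z < m by lia.
move=> /(_ isT (uE _)); rewrite !uE.
have -> : 3 * (- m - 1) ^+ 2 + (- m - 1) = 3 * m ^+ 2 + m + (4 * m + 2) by ring.
have -> : 3 * (m + 1) ^+ 2 + (m + 1) = 3 * m ^+ 2 + m + (6 * m + 4) by ring.
rewrite !opprD !addrA => /(_ erefl erefl); move: IHL; rewrite uE !opprD !addrA.
have -> : L.+1%:Z = L%:Z + 1 by lia.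
by move: (Num.max _ _) (Num.max _ _) (Num.max _ _) => u0 u1 u2; lra.
Qed.

(** The pairs are now -m and m with m = c + 2 + L. Starting from [-1, 1] or wider supplies the bound
    L + 2 <= m of [odd_pair_step]. *)
Lemma odd_tail_le0 (c M j : nat) : (j <= M)%N ->
  coefs (ramp * tail (- c.+1%:Z) c.+1%:Z M) j <= 0.
Proof.
move=> jM; have [oj|ej] := boolP (odd j); first by rewrite coefs_ramp_odd.
pose u n := (j.+2 - texp n)%N%:Z.
have uE n : u n = Num.max (j%:Z + 2 - (3 * n ^+ 2 + n)) 0.
  by have := texpE n; rewrite /u => <-; case: lerP; lia.
(* The slack is borrowed from -m, which has the smaller exponent of the pair; it too is 0 at L =
   M. *)
suff inv L : coefs (ramp * tail (- c.+1%:Z) c.+1%:Z L) j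
                 <= 2 * L%:Z * u (- (c.+2%:Z + L%:Z)).
  have := inv M; rewrite (_ : u _ = 0) ?mulr0 //.
  have nn : 0 <= (c%:Z + M%:Z) ^+ 2 by exact: sqr_ge0.
  by rewrite uE; case: lerP => //; nia.
elim: L => [|L IHL]; first by rewrite /tail big_ord0 mulr0 coefs0 mulr0 mul0r.
rewrite tailS mulrDr coefsD mulrDr coefsD !coefs_ramp_sterm (negPf ej) -!/(u _).
set m := c.+2%:Z + L%:Z in IHL *.
have mE : m = c.+2%:Z + L%:Z by []; clearbody m.
have -> : - c.+1%:Z - 1 - L%:Z = - m by lia.
have -> : c.+1%:Z + 1 + L%:Z = m by lia.
have -> : - (c.+2%:Z + L.+1%:Z) = - m - 1 by lia.
have := @odd_pair_step (j%:Z + 2 - (3 * m ^+ 2 - m)) m L%:Z (u (- m))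
  (u m) (u (- m - 1)) isT.
have -> : L%:Z + 2 <= m by lia.
move=> /(_ isT); rewrite !uE.
have -> : 3 * (- m) ^+ 2 + - m = 3 * m ^+ 2 - m by ring.
have -> : 3 * m ^+ 2 + m = 3 * m ^+ 2 - m + 2 * m by ring.
have -> : 3 * (- m - 1) ^+ 2 + (- m - 1) = 3 * m ^+ 2 - m + (6 * m + 2) by ring.
rewrite !opprD !addrA => /(_ erefl erefl erefl); move: IHL.
rewrite uE sqrrN !opprD !addrA.
have -> : L.+1%:Z = L%:Z + 1 by lia.
by move: (Num.max _ _) (Num.max _ _) (Num.max _ _) => u0 u1 u2; lra.
Qed.

(** * Signs after division by the denominator, and the case analysis on a and b *)

Lemma ssumE N : ssum N = \sum_(n <- zrange (- N%:Z) N%:Z) sterm n.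
Proof. by []. Qed.

(** Up to index k the quotient agrees with the constant series 1; this is where [1 <= k] enters. *)
Lemma coefs_inv_den_ssum N k : (1 <= k)%N -> (2 * k.+2 <= N)%N ->
  coefs (den^-1 * ssum N) k = 0.
Proof.
move=> k1 kN; transitivity (coefs (den^-1 * den) k).
  by apply: (@eqXM _ k.+1) => //; exact: ssum_lim.
by rewrite mulVr ?den_unit // coefs1; case: k k1 {kN}.
Qed.

Lemma coefs_inv_den_ge0 f k :
  (forall j, (j <= k)%N -> 0 <= coefs (ramp * f) j) -> 0 <= coefs (den^-1 * f) k.
Proof.
move=> f0; have [g g0 gE] := inv_den.
suff : 0 <= 2 * coefs (den^-1 * f) k by rewrite pmulr_rge0.
rewrite -coefs_intrM mulrA gE -mulrA; exact: coefsM_ge0.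
Qed.

Lemma coefs_inv_den_sterm n k : 0 <= n -> 0 <= coefs (den^-1 * sterm n) k.
Proof.
move=> n0; apply: coefs_inv_den_ge0 => j _; rewrite coefs_ramp_sterm.
by case: ifP => // _; rewrite mulr_ge0 //; lia.
Qed.

Lemma coefs_inv_den_stermN n k : n < 0 -> coefs (den^-1 * sterm n) k <= 0.
Proof.
move=> n0; rewrite -oppr_ge0 -coefsN -mulrN; apply: coefs_inv_den_ge0 => j _.
rewrite mulrN coefsN coefs_ramp_sterm; case: ifP => // _.
by rewrite -mulNr mulr_ge0 //; lia.
Qed.

(** A long symmetric sum contributes 0, so only minus the tail remains. *)
Lemma coefs_inv_den_odd (c k : nat) : (1 <= k)%N ->
  0 <= coefs (den^-1 * \sum_(n <- zrange (- c%:Z) c%:Z) sterm n) k.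
Proof.
case: c => [|c] k1.
  (* The range {0} is treated apart: [odd_pair_step] does not apply to the pair with m = 1. *)
  rewrite (_ : zrange _ _ = [:: 0]) // big_seq1; exact: coefs_inv_den_sterm.
have cc : - c.+1%:Z <= c.+1%:Z + 1 by lia.
pose M := (2 * k.+2)%N; have := big_zrange_grow M cc.
have -> : - c.+1%:Z - M%:Z = - (c.+1 + M)%N%:Z by lia.
rewrite -PoszD -ssumE => /esym/(canRL (addrK _)) ->.
rewrite mulrBr coefsB coefs_inv_den_ssum ?sub0r //; last by rewrite /M; lia.
rewrite -coefsN -mulrN; apply: coefs_inv_den_ge0 => j jk.
by rewrite mulrN coefsN oppr_ge0; apply: odd_tail_le0; rewrite /M; lia.
Qed.

Lemma coefs_inv_den_even (c k : nat) : (1 <= k)%N ->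
  coefs (den^-1 * \sum_(n <- zrange (- c%:Z - 1) c%:Z) sterm n) k <= 0.
Proof.
move=> k1; have cc : - c%:Z - 1 <= c%:Z + 1 by lia.
pose M := (2 * k.+2)%N; have := big_zrange_grow M cc.
have -> : - c%:Z - 1 - M%:Z = - (c + M)%N%:Z - 1%:Z by lia.
(* The grown range is a symmetric one plus a single term of negative index, whose contribution has
   the wanted sign. *)
rewrite -PoszD big_zrange_recl ?big_ord1; last by lia.
rewrite -ssumE => /esym/(canRL (addrK _)) ->.
rewrite mulrBr mulrDr coefsB coefsD coefs_inv_den_ssum ?add0r //; last first.
  by rewrite /M; lia.
rewrite subr_le0 (le_trans (y := 0)) //.
  by apply: coefs_inv_den_stermN; lia.
by apply: coefs_inv_den_ge0 => j jk; apply: even_tail_ge0; rewrite /M; lia.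
Qed.

Theorem theorem1p7 (a b : int) (k : nat) (hk : (1 <= k)%N) :
  let q : fps int := fpsX int in
  0 <= coefs ((Sg (a + b))%:~R
              / (qpoch (q ^+ 2) (q ^+ 2) ^+ 3 * qpoch (q ^+ 2) (q ^+ 4) ^+ 2)
              * \sum_(n <- zrange a b) (6 * n + 1)%:~R * q ^+ texp n) k.
Proof.
cbv zeta; rewrite -/den -mulrA coefs_intrM.
rewrite -[\sum_(n <- _) _]/(\sum_(n <- zrange a b) sterm n).
have sumM (F : int -> fps int) (s : seq int) :
    coefs (den^-1 * \sum_(n <- s) F n) k =
    \sum_(n <- s) coefs (den^-1 * F n) k by rewrite mulr_sumr coefs_sum.
have [ab|ba] := lerP a b; last first.
  by rewrite /zrange (lt_geF ba) big_nil mulr0 coefs0 mulr0.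
rewrite /Sg; case: ifPn => [ab0|ab0].
  rewrite mul1r; have [a0|a0] := lerP 0 a.
    rewrite sumM big_seq sumr_ge0 // => n; rewrite mem_zrange => /andP[an _].
    by apply: coefs_inv_den_sterm; lia.
  (* Here a < 0 <= a + b: the range is [-|a|, |a|] followed by terms of positive index, which only
     help. *)
  have -> : a = - `|a|%N%:Z by lia.
  have -> : b = `|a|%N%:Z + (absz (b + a))%:Z by lia.
  rewrite big_zrange_recr; last by lia.
  rewrite mulrDr coefsD addr_ge0 ?coefs_inv_den_odd //.
  rewrite mulr_sumr coefs_sum sumr_ge0 // => i _.
  by apply: coefs_inv_den_sterm; lia.
rewrite mulN1r oppr_ge0; have [b0|b0] := lerP 0 b; last first.
  rewrite sumM big_seq sumr_le0 // => n; rewrite mem_zrange => /andP[_ nb].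
  by apply: coefs_inv_den_stermN; lia.
(* Here b >= 0 and a + b < 0: the range is [-b-1, b] preceded by terms of negative index. *)
have -> : b = `|b|%N%:Z by lia.
have -> : a = - `|b|%N%:Z - 1 - (absz (b + a + 1))%:Z by lia.
rewrite big_zrange_recl; last by lia.
rewrite mulrDr coefsD -oppr_ge0 opprD addr_ge0 ?oppr_ge0 ?coefs_inv_den_even //.
rewrite mulr_sumr coefs_sum sumr_le0 // => i _.
by apply: coefs_inv_den_stermN; lia.
Qed.
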